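(* Let $G=(V,E,\omega)$ be a finite undirected connected weighted graph, let $\emptyset\neq U\subseteq V$, let $m\geq 1$, let $g\colon U\to\mathbb{R}^m$ and let $v\colon V\to\mathbb{R}^m$ be its tight extension. Then $v$ is discrete $\infty$-harmonic, i.e. for all $x\in V\setminus U$ $$v(x)\in\operatorname*{arg\,min}_{a\in\mathbb{R}^m}\Big\{\max_{y\sim x}\sqrt{\omega(x,y)}\,|v(y)-a|\Big\}.$$
   Context: $G=(V,E,\omega)$ is a finite undirected connected weighted graph with symmetric weights $\omega(x,y)\in[0,1]$, where $\omega(x,y)=0$ if and only if $(x,y)\notin E$; write $x\sim y$ iff $(x,y)\in E$. $|\cdot|$ is the Euclidean norm. For $u\colon V\to\mathbb{R}^m$ and $x\in V$ the local Lipschitz constant is $Su(x)=\max_{y\sim x}\sqrt{\omega(x,y)}\,|u(y)-u(x)|$. For $u,v\colon V\to\mathbb{R}^m$ with $u|_U=v|_U$, $u$ is called tighter than $v$ if $$\max\{Sv(x): x\in V\setminus U,\ Su(x)<Sv(x)\}>\max\{Su(x): x\in V\setminus U,\ Sv(x)<Su(x)\},$$ where the maximum over the empty set is $0$. A function $u$ is called tight if there is no $v\colon V\to\mathbb{R}^m$ with $v|_U=u|_U$ that is tighter than $u$. For each $g\colon U\to\mathbb{R}^m$ there is exactly one tight $u\colon V\to\mathbb{R}^m$ with $u|_U=g$, called the tight extension of $g$. *)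

(* Defs.v *)
From HB Require Import structures.
From mathcomp Require Import all_boot all_order all_algebra.
From mathcomp Require Import classical_sets reals.

Set Implicit Arguments.
Unset Strict Implicit.
Unset Printing Implicit Defensive.

Import Order.TTheory GRing.Theory Num.Theory.
Local Open Scope ring_scope.

(* Loops are not excluded: they contribute 0 to [locLip] and can only increase
   [nbr_max v x a] at points a other than v x. *)
Record weighted_graph (R : realType) (V : finType) (E : rel V)
    (w : V -> V -> R) : Prop := WeightedGraph {
  edge_sym : symmetric E;
  weight_sym : forall x y, w x y = w y x;
  weight_itv : forall x y, 0 <= w x y <= 1;
  weight_eq0 : forall x y, w x y = 0 <-> ~~ E x y
}.

Definition connected_graph (V : finType) (E : rel V) : Prop :=
  forall x y : V, connect E x y.

(* The norm that MathComp-Analysis puts on ['rV[R]_m] is the sup norm. *)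
Definition enorm (R : realType) (m : nat) (a : 'rV[R]_m) : R :=
  Num.sqrt (\sum_(i < m) a ord0 i ^+ 2).

Definition argmin (R : realType) (T : Type) (F : T -> R) : set T :=
  [set a | forall b, F a <= F b]%classic.

Section Tight.
Variables (R : realType) (V : finType) (E : rel V) (w : V -> V -> R).
Variable m : nat.
Implicit Types (U : {set V}) (u v : V -> 'rV[R]_m) (x : V).

(* max_(y ~ x) sqrt(w x y) |u y - a|; the terms are nonnegative, so the
   default 0 only matters when x has no neighbour. *)
Definition nbr_max u x (a : 'rV[R]_m) : R :=
  \big[Num.max/0]_(y | E x y) (Num.sqrt (w x y) * enorm (u y - a)).

Definition locLip u x : R := nbr_max u x (u x).

(* Only meaningful for u and v that agree on U. *)
Definition tighter U u v : Prop :=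
  \big[Num.max/0]_(x | (x \notin U) && (locLip v x < locLip u x)) locLip u x <
  \big[Num.max/0]_(x | (x \notin U) && (locLip u x < locLip v x)) locLip v x.

Definition tight U u : Prop :=
  ~ exists v, {in U, v =1 u} /\ tighter U v u.

Definition tight_extension U (g : {x | x \in U} -> 'rV[R]_m) v : Prop :=
  (forall x : {x | x \in U}, v (val x) = g x) /\ tight U v.

Definition infty_harmonic U v : Prop :=
  forall x, x \notin U -> argmin (nbr_max v x) (v x).

End Tight.

(* Main.v *)
Require Import Defs.
From HB Require Import structures.
From mathcomp Require Import all_boot all_order all_algebra.
From mathcomp Require Import reals.

(** If v fails to minimise [nbr_max v x] at some x outside U, a point b with a
    smaller value of [nbr_max v x] yields a competitor u: move v x to b and
    leave every other vertex alone.  The only edges along which the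
    difference changes join x to another vertex, so their weighted lengths are
    now at most [nbr_max v x b].  Hence the local Lipschitz constant drops at x, from
    [locLip v x] to at most [nbr_max v x b] ([locLip_move_self]), and wherever
    it rises it is still at most [nbr_max v x b] ([locLip_move_le]).  As
    [nbr_max v x b] < [locLip v x], u is tighter than v ([move_tighter]). *)

Set Implicit Arguments.
Unset Strict Implicit.
Unset Printing Implicit Defensive.

Import Order.TTheory GRing.Theory Num.Theory.
Local Open Scope ring_scope.

Section Enorm.
Variables (R : realType) (m : nat).

Lemma enorm0 : enorm (0 : 'rV[R]_m) = 0.
Proof. by rewrite /enorm big1 ?sqrtr0 // => i _; rewrite mxE expr0n. Qed.

Lemma enorm_distC (a b : 'rV[R]_m) : enorm (a - b) = enorm (b - a).
Proof.
rewrite -opprB /enorm; congr (Num.sqrt _).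
by apply: eq_bigr => i _; rewrite mxE sqrrN.
Qed.

End Enorm.

Section Move.
Variables (R : realType) (V : finType) (E : rel V) (w : V -> V -> R).
Hypothesis hG : weighted_graph E w.
Variables (m : nat) (v : V -> 'rV[R]_m) (x : V) (b : 'rV[R]_m).

Let u : V -> 'rV[R]_m := @dfwith _ _ v x b.

Lemma nbr_max_ge0 y a : 0 <= nbr_max E w v y a.
Proof. exact: bigmax_ge_id. Qed.

Lemma nbr_max_ge y z a :
  E y z -> Num.sqrt (w y z) * enorm (v z - a) <= nbr_max E w v y a.
Proof. by move=> Eyz; exact: (le_bigmax_cond _ _ Eyz). Qed.

(** This is an inequality, not an equality, because of a possible loop at x:
    it contributes nothing to the left-hand side, but the distance from v x
    to b to the right-hand side. *)
Lemma locLip_move_self : locLip E w u x <= nbr_max E w v x b.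
Proof.
apply: bigmax_le => [|z Exz]; first exact: nbr_max_ge0.
rewrite /u dfwith_in; have [<-|xz] := eqVneq x z.
  by rewrite dfwith_in subrr enorm0 mulr0 nbr_max_ge0.
by rewrite dfwith_out // nbr_max_ge.
Qed.

(** An edge at y that does not lead to x is unchanged, and the edge from y to
    x is, by symmetry, among those over which [nbr_max v x b] is taken. *)
Lemma locLip_move_le y :
  locLip E w u y <= Num.max (locLip E w v y) (nbr_max E w v x b).
Proof.
have [<-|xy] := eqVneq x y; first by rewrite le_max locLip_move_self orbT.
apply: bigmax_le => [|z Eyz]; first by rewrite le_max nbr_max_ge0.
rewrite /u (dfwith_out _ _ xy) le_max; have [xz|xz] := eqVneq x z.
  rewrite -xz dfwith_in enorm_distC (weight_sym hG) nbr_max_ge ?orbT //.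
  by rewrite (edge_sym hG) xz.
by rewrite dfwith_out // nbr_max_ge.
Qed.

Lemma move_tighter (U : {set V}) :
  x \notin U -> nbr_max E w v x b < locLip E w v x -> tighter E w U u v.
Proof.
move=> xU ltb.
have rise : \big[Num.max/0]_(y | (y \notin U) &&
    (locLip E w v y < locLip E w u y)) locLip E w u y <= nbr_max E w v x b.
  apply: bigmax_le => [|y /andP[_ lty]]; first exact: nbr_max_ge0.
  by have := locLip_move_le y; rewrite le_max leNgt lty.
apply: le_lt_trans rise (lt_le_trans ltb _).
by apply: le_bigmax_cond; rewrite xU (le_lt_trans locLip_move_self ltb).
Qed.

End Move.

Theorem theorem5p31 (R : realType) (V : finType) (E : rel V)
    (w : V -> V -> R) (hG : weighted_graph E w) (hconn : connected_graph E)
    (U : {set V}) (hU : U != set0) (m : nat) (hm : (0 < m)%N)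
    (g : {x | x \in U} -> 'rV[R]_m) (v : V -> 'rV[R]_m)
    (hv : tight_extension E w g v) :
  infty_harmonic E w U v.
Proof.
move=> x xU b; rewrite leNgt; apply/negP => ltb.
case: hv => _; apply; exists (@dfwith _ _ v x b).
split; last exact: move_tighter.
by move=> y yU; rewrite dfwith_out //; apply: contraNneq xU => ->.
Qed.
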